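(* Let $1\le k<d$ and $t\ge1$. (i) For every $\alpha\in\mathbb{N}^d$ with $|\alpha|=t$ there are real coefficients $a^\alpha_\beta$ ($|\beta|\le t$), which make the identity $\mathbb{E}X^\alpha=\sum_{|\beta|\le t}a^\alpha_\beta\sum_j\omega_j\mathbb{E}(P_jX)^\beta$ valid for every exact cubature $\{(P_j,\omega_j)\}$ for $\mathrm{Pol}^2_t(\mathcal{G}_{k,d})$ and every random vector $X$ in $\mathbb{S}^{d-1}$, and a constant $c_\alpha\ge0$, such that for every $\epsilon\ge0$, every $\epsilon$-approximate cubature $\{(P_j,\omega_j)\}_{j=1}^n$ for $\mathrm{Pol}_t(\mathcal{G}_{k,d})$ with respect to $K_t$ and every random vector $X$ with values in $\mathbb{S}^{d-1}$, $$\Big|\mathbb{E}X^\alpha-\sum_{|\beta|\le t}a^\alpha_\beta\sum_{j=1}^n\omega_j\mathbb{E}(P_jX)^\beta\Big|\le\epsilon\,c_\alpha.$$ (ii) If $k=1$ and $t\le d$, then for every $\alpha\in\mathbb{N}^d$ with $|\alpha|=t$ there are real coefficients $a^\alpha_\beta$ ($|\beta|=t$), which make the identity $\mathbb{E}X^\alpha=\sum_{|\beta|=t}a^\alpha_\beta\sum_j\omega_j\mathbb{E}(P_jX)^\beta$ valid for every exact cubature for $\mathrm{Pol}^3_t(\mathcal{G}_{1,d})$, and a constant $c\ge0$, such that for every $\epsilon$-approximate cubature $\{(P_j,\omega_j)\}_{j=1}^n$ for $\mathrm{Pol}_t(\mathcal{G}_{1,d})$ with respect to $K_t$ and every random vector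 $X$ in $\mathbb{R}^d$ with $\mathbb{E}\|X\|^t<\infty$, $$\Big|\mathbb{E}X^\alpha-\sum_{|\beta|=t}a^\alpha_\beta\sum_{j=1}^n\omega_j\mathbb{E}(P_jX)^\beta\Big|\le c\,\epsilon\,\mathbb{E}\|X\|^t.$$
   Context: $\mathscr{H}_d$ denotes the real symmetric $d\times d$ matrices with $\langle A,B\rangle=\operatorname{trace}(AB)$. $\mathcal{G}_{k,d}=\{P\in\mathscr{H}_d:P^2=P,\ \operatorname{trace}(P)=k\}$, with orthogonally invariant Borel probability measure $\sigma_{k,d}$. $\mathrm{Pol}_t(\mathcal{G}_{k,d})$ is the space of restrictions to $\mathcal{G}_{k,d}$ of polynomials of degree at most $t$ on $\mathscr{H}_d$; $\mathrm{Pol}^\ell_t(\mathcal{G}_{k,d})$ is the span of $P\mapsto\langle M,P\rangle^s$ with $\operatorname{rank}M\le\ell$, $s\le t$. An (exact) cubature for a space $V$ is a family $\{(P_j,\omega_j)\}$, $P_j\in\mathcal{G}_{k,d}$, $\omega_j\in\mathbb{R}$, with $\sum_j\omega_jf(P_j)=\int f\,d\sigma_{k,d}$ for all $f\in V$. $K_t(P,Q)=\langle P,Q\rangle^t$; it induces the norm $\|f\|_{K_t}^2=\sum_{i,j}c_ic_jK_t(Q_i,Q_j)$ on $\mathrm{Pol}_t(\mathcal{G}_{k,d})$ for $f=\sum_ic_iK_t(Q_i,\cdot)$. A family $\{(P_j,\omega_j)\}$ is an $\epsilon$-approximate cubature for $\mathrm{Pol}_t(\mathcal{G}_{k,d})$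 with respect to $K_t$ if $|\sum_j\omega_jf(P_j)-\int f\,d\sigma_{k,d}|\le\epsilon$ for all $f\in\mathrm{Pol}_t(\mathcal{G}_{k,d})$ with $\|f\|_{K_t}=1$. Multi-index notation: $X^\alpha=X_1^{\alpha_1}\cdots X_d^{\alpha_d}$ and $(P_jX)^\beta$ the corresponding power of $P_jX$. The constants may depend on $\alpha,k,d$. *)

(* Defs.v *)
From HB Require Import structures.
From mathcomp Require Import all_boot all_order all_algebra.
From mathcomp Require Import all_classical all_reals all_analysis.

Set Implicit Arguments.
Unset Strict Implicit.
Unset Printing Implicit Defensive.

Import Order.TTheory GRing.Theory Num.Theory.
Import numFieldTopology.Exports numFieldNormedType.Exports.
Local Open Scope ring_scope.

Definition hsprod (R : realType) (d : nat) (A B : 'M[R]_d) : R := \tr (A *m B).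

Definition symmetric_mx (R : realType) (d : nat) (A : 'M[R]_d) : Prop := A^T = A.

Definition grass (R : realType) (k d : nat) (P : 'M[R]_d) : Prop :=
  P^T = P /\ P *m P = P /\ \tr P = k%:R.

(* Q : TS -> 'M_d is a random matrix whose law (under PS) is the orthogonally
   invariant Borel probability measure sigma_{k,d} on G_{k,d}:
   entries measurable, values in G_{k,d}, and the law of O Q O^T equals the
   law of Q for every orthogonal O (tested against continuous functions). *)
Definition grass_law (R : realType) (k d : nat) (dS : measure_display)
  (TS : measurableType dS) (PS : probability TS R) (Q : TS -> 'M[R]_d) : Prop :=
  (forall i l, measurable_fun setT (fun w => Q w i l)) /\
  (forall w, grass k (Q w)) /\
  (forall O : 'M[R]_d, O^T *m O = 1%:M ->
     forall g : 'M[R]_d -> R, continuous g ->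
       ('E_PS[fun w => g (O *m Q w *m O^T)] = 'E_PS[fun w => g (Q w)])%E).

Definition sigma_int (R : realType) (d : nat) (dS : measure_display)
  (TS : measurableType dS) (PS : probability TS R) (Q : TS -> 'M[R]_d)
  (f : 'M[R]_d -> R) : \bar R := ('E_PS[fun w => f (Q w)])%E.

Definition in_PolL (R : realType) (l t k d : nat) (f : 'M[R]_d -> R) : Prop :=
  exists (m : nat) (b : 'I_m -> R) (M : 'I_m -> 'M[R]_d) (s : 'I_m -> nat),
    (forall i, symmetric_mx (M i) /\ (\rank (M i) <= l)%N /\ (s i <= t)%N) /\
    (forall P, grass k P -> f P = \sum_(i < m) b i * hsprod (M i) P ^+ s i).

Definition cubature (R : realType) (k d : nat) (V : ('M[R]_d -> R) -> Prop)
  (dS : measure_display) (TS : measurableType dS) (PS : probability TS R)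
  (Q : TS -> 'M[R]_d) (n : nat) (P : 'I_n -> 'M[R]_d) (w : 'I_n -> R) : Prop :=
  (forall j, grass k (P j)) /\
  (forall f, V f -> ((\sum_(j < n) w j * f (P j))%:E = sigma_int PS Q f)%E).

Definition Kt_fun (R : realType) (d t m : nat) (c : 'I_m -> R)
  (Qs : 'I_m -> 'M[R]_d) (P : 'M[R]_d) : R :=
  \sum_(i < m) c i * hsprod (Qs i) P ^+ t.

Definition Kt_norm2 (R : realType) (d t m : nat) (c : 'I_m -> R)
  (Qs : 'I_m -> 'M[R]_d) : R :=
  \sum_(i < m) \sum_(i' < m) c i * c i' * hsprod (Qs i) (Qs i') ^+ t.

Definition approx_cubature (R : realType) (k d t : nat) (eps : R)
  (dS : measure_display) (TS : measurableType dS) (PS : probability TS R)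
  (Q : TS -> 'M[R]_d) (n : nat) (P : 'I_n -> 'M[R]_d) (w : 'I_n -> R) : Prop :=
  (forall j, grass k (P j)) /\
  (forall (m : nat) (c : 'I_m -> R) (Qs : 'I_m -> 'M[R]_d),
     (forall i, grass k (Qs i)) -> Kt_norm2 t c Qs = 1 ->
     (`| (\sum_(j < n) w j * Kt_fun t c Qs (P j))%:E
         - sigma_int PS Q (Kt_fun t c Qs) | <= eps%:E)%E).

Definition mono (R : realType) (d : nat) (beta : 'I_d -> nat) (x : 'I_d -> R) : R :=
  \prod_(i < d) x i ^+ beta i.

Definition mxv (R : realType) (d : nat) (P : 'M[R]_d) (x : 'I_d -> R) : 'I_d -> R :=
  fun i => \sum_(l < d) P i l * x l.

Definition enorm (R : realType) (d : nat) (x : 'I_d -> R) : R :=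
  Num.sqrt (\sum_(i < d) x i ^+ 2).

Definition mdeg (d t : nat) (beta : {ffun 'I_d -> 'I_t.+1}) : nat :=
  \sum_(i < d) (beta i : nat).

(* Main.v *)
(* Homogeneous coefficients suffice: the averaging operator sending a form [f]
   of degree [t] to [x |-> E f(Q x)] is injective, hence onto, on forms of
   degree [t], for every [k >= 1], so that [x^alpha] is the average of
   [sum_beta a_beta (Q x)^beta] with [|beta| = t], for all [x] in [R^d].
   In tensor form, the mean of the [t]-fold tensor power of the projection [Q]
   is positive semidefinite, and a symmetric tensor in its kernel is killed by
   almost all these tensor powers, so its form vanishes on almost all ranges
   of [Q], and by invariance of the law everywhere.
   For fixed [x], [P |-> sum_beta a_beta (P x)^beta] is a combination of powers
   [<M, P>^t] with [M] a symmetrised rank one matrix, whence the exact case.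
   It is also the pairing of the [t]-th tensor power of [P] with a tensor of
   norm proportional to [|x|^t]; projecting that tensor orthogonally onto the
   span of the tensor powers of [G_{k,d}] expresses it through [K_t] without
   increasing the norm, whence the bound by [eps |x|^t]. *)
Require Import Defs.
From HB Require Import structures.
From mathcomp Require Import all_boot all_order all_algebra.
From mathcomp Require Import all_classical all_reals all_analysis.
From mathcomp Require Import measurable_realfun ring.
Import Order.TTheory GRing.Theory Num.Theory.
Local Open Scope ring_scope.

Set Implicit Arguments.
Unset Strict Implicit.
Unset Printing Implicit Defensive.

Import numFieldTopology.Exports numFieldNormedType.Exports.

(** * Linear algebra over finite index types *)

Definition dot (R : realType) (T : finType) (x y : T -> R) : R :=
  \sum_i x i * y i.

Definition lincomb (R : realType) (T : finType) (m : nat)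
  (c : 'I_m -> R) (v : 'I_m -> T -> R) : T -> R :=
  fun i => \sum_(l < m) c l * v l i.

Definition in_span (R : realType) (T : finType) (S : (T -> R) -> Prop)
  (s : T -> R) : Prop :=
  exists (m : nat) (c : 'I_m -> R) (v : 'I_m -> T -> R),
    (forall l, S (v l)) /\ s = lincomb c v.

(** Passage to row vectors, which gives access to ranks, row spaces and cokernels. *)
Definition rowT (R : realType) (T : finType) (x : T -> R) : 'rV[R]_#|T| :=
  \row_j x (enum_val j).

Lemma dotC (R : realType) (T : finType) (x y : T -> R) :
  dot x y = dot y x.
Proof. by apply: eq_bigr => i _; rewrite mulrC. Qed.

Lemma dot_lincomb (R : realType) (T : finType) (m : nat)
  (c : 'I_m -> R) (v : 'I_m -> T -> R) (y : T -> R) :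
  dot (lincomb c v) y = \sum_(l < m) c l * dot (v l) y.
Proof.
rewrite /dot /lincomb; under eq_bigr do rewrite mulr_suml.
rewrite exchange_big; apply: eq_bigr => l _; rewrite mulr_sumr.
by apply: eq_bigr => i _; rewrite mulrA.
Qed.

Lemma dot_ge0 (R : realType) (T : finType) (x : T -> R) : 0 <= dot x x.
Proof. by apply: sumr_ge0 => i _; rewrite -expr2 sqr_ge0. Qed.

Lemma dot_eq0 (R : realType) (T : finType) (x : T -> R) :
  dot x x = 0 -> x = (fun=> 0).
Proof.
move=> /eqP; rewrite psumr_eq0 => [/allP h|i _]; last by rewrite -expr2 sqr_ge0.
apply/funext => i; have := h i (mem_index_enum i).
by rewrite /= -expr2 sqrf_eq0 => /eqP.
Qed.

Lemma dot_rowT (R : realType) (T : finType) (x y : T -> R) :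
  dot x y = (rowT x *m (rowT y)^T) 0 0.
Proof.
rewrite mxE /dot (eq_bigl (fun i => i \in T)) // big_enum_val.
by apply: eq_bigr => j _; rewrite !mxE.
Qed.

Definition formT (R : realType) (T : finType) (E : T -> T -> R) : 'M[R]_#|T| :=
  \matrix_(i, j) E (enum_val i) (enum_val j).

Lemma dot_form_rowT (R : realType) (T : finType) (E : T -> T -> R) (x y : T -> R) :
  dot x (fun i => dot (E i) y) =
  (rowT x *m formT E *m (rowT y)^T) 0 0.
Proof.
rewrite -mulmxA dot_rowT; congr ((_ *m _) 0 0); apply/matrixP => i j.
by rewrite !mxE dot_rowT mxE; apply: eq_bigr => l _; rewrite !mxE.
Qed.

Lemma rowT_lincomb (R : realType) (T : finType) (m : nat)
  (c : 'I_m -> R) (v : 'I_m -> T -> R) :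
  rowT (lincomb c v) = (\row_l c l) *m (\matrix_l rowT (v l)).
Proof. by apply/rowP => j; rewrite !mxE; apply: eq_bigr => l _; rewrite !mxE. Qed.

(** Since [S] may be infinite, a finite family from [S] of maximal rank is chosen, the rank being at
    most [#|T|]; a member of [S] outside its row space could be adjoined to raise the rank. *)
Lemma spanning_family (R : realType) (T : finType) (S : (T -> R) -> Prop) :
  exists (m : nat) (v : 'I_m -> T -> R), (forall l, S (v l)) /\
    forall u, S u -> (rowT u <= \matrix_l rowT (v l))%MS.
Proof.
pose P r := `[< exists (m : nat) (v : 'I_m -> T -> R), (forall l, S (v l)) /\
  \rank (\matrix_l rowT (v l)) = r >].
have exP : exists r, P r.
  exists 0; apply/asboolP; exists 0, (fun=> fun=> 0); split; first by case.
  by apply/eqP; rewrite mxrank_eq0; apply/eqP/matrixP; case.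
have ubP r : P r -> (r <= #|T|)%N.
  by move=> /asboolP[m [v [_ <-]]]; apply: rank_leq_col.
case: (ex_maxnP exP ubP) => r /asboolP[m [v [Sv rv]]] rmax.
exists m, v; split => // u Su.
pose v' (l : 'I_m.+1) := if unlift ord0 l is Some l' then v l' else u.
have sub : (\matrix_l rowT (v l) <= \matrix_l rowT (v' l))%MS.
  apply/row_subP => l; rewrite rowK.
  by have <- : row (lift ord0 l) (\matrix_l rowT (v' l)) = rowT (v l);
    [rewrite rowK /v' liftK | apply: row_sub].
have [_ eqr] := mxrank_leqif_sup sub.
have : (\matrix_l rowT (v' l) <= \matrix_l rowT (v l))%MS.
  rewrite -eqr eqn_leq mxrankS //= rv; apply: rmax; apply/asboolP.
  exists m.+1, v'; split => // l; rewrite /v'.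
  by case: (unlift ord0 l) => [l'|].
apply: submx_trans.
by have <- : row ord0 (\matrix_l rowT (v' l)) = rowT u;
    [rewrite rowK /v' unlift_none | apply: row_sub].
Qed.

(** On a finite-dimensional span, a form without nonzero isotropic vectors is nondegenerate, so it
    represents every linear functional, in particular the pairing with [tau]. *)
Lemma solve_span (R : realType) (T : finType) (S : (T -> R) -> Prop)
  (E : T -> T -> R) :
  (forall s, in_span S s -> dot s (fun i => dot (E i) s) = 0 ->
     s = (fun=> 0)) ->
  forall tau : T -> R, exists a, in_span S a /\
    forall u, S u -> dot a (fun i => dot (E i) u) = dot tau u.
Proof.
move=> defE tau; have [m [v [Sv spanv]]] := spanning_family S.
pose W := \matrix_l rowT (v l).
pose F := formT E.
have /submxP[D hD] : (rowT tau *m W^T <= W *m F *m W^T)%MS.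
  apply: (submx_trans (submxMl _ _)); rewrite submxE.
  (* Each column of [K] gives a combination [s] of the [v l] on which the form vanishes; hence [s]
     is zero, which says that [K] also annihilates [W^T]. *)
  set K := cokermx _; apply/eqP/matrixP => j l; rewrite [RHS]mxE.
  pose s := lincomb (fun i => K i l) v.
  have rs : rowT s = (col l K)^T *m W.
    by rewrite rowT_lincomb; congr (_ *m _); apply/rowP => i; rewrite !mxE.
  suff s0 : s = (fun=> 0).
    transitivity (rowT s 0 j); last by rewrite s0 !mxE.
    by rewrite rs !mxE; apply: eq_bigr => i _; rewrite !mxE mulrC.
  apply: defE; first by exists m, (fun i => K i l), v.
  rewrite dot_form_rowT rs trmx_mul trmxK -/F.
  have -> : (col l K)^T *m W *m F *m (W^T *m col l K) =
    (col l K)^T *m (W *m F *m W^T *m col l K) by rewrite !mulmxA.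
  by rewrite colE (mulmxA _ K) mulmx_coker mul0mx mulmx0 mxE.
exists (lincomb (D 0) v); split; first by exists m, (D 0), v.
move=> u /spanv /submxP[x hx].
rewrite dot_form_rowT rowT_lincomb -/W -/F.
have -> : \row_l D 0 l = D by apply/rowP => l; rewrite mxE.
rewrite dot_rowT hx trmx_mul !mulmxA.
by move: hD; rewrite !mulmxA => ->.
Qed.

(** The vector [a] is the orthogonal projection of [tau] onto the span of [S], obtained from
    [solve_span] with the identity form. The bound is the nonnegativity of the squared norm of
    [tau - a], since [dot a a = dot tau a]. *)
Lemma span_representer (R : realType) (T : finType) (S : (T -> R) -> Prop)
  (tau : T -> R) :
  exists a, [/\ in_span S a, forall u, S u -> dot a u = dot tau u &
    dot a a <= dot tau tau].
Proof.
pose E (i j : T) : R := (i == j)%:R.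
have EI x : (fun i => dot (E i) x) = x.
  apply/funext => i; rewrite /dot (bigD1 i) //= /E eqxx mul1r big1 ?addr0 // => j.
  by rewrite eq_sym => /negbTE ->; rewrite mul0r.
have [s _|a [aS ha]] := @solve_span R T S E _ tau.
  by rewrite EI; apply: dot_eq0.
exists a; split => // [u Su|]; first by rewrite -ha // EI.
have aa : dot a a = dot tau a.
  case: aS => m [c [v [Sv av]]].
  have ya y : dot y a = \sum_(l < m) c l * dot y (v l).
    by rewrite av dotC dot_lincomb; apply: eq_bigr => l _; rewrite dotC.
  by rewrite !ya; apply: eq_bigr => l _; rewrite -ha // EI.
have := dot_ge0 (fun i => tau i - a i).
have -> : dot (fun i => tau i - a i) (fun i => tau i - a i) =
  dot tau tau - dot tau a - (dot tau a - dot a a).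
  rewrite /dot -!sumrB; apply: eq_bigr => i _.
  by rewrite mulrBl !mulrBr (mulrC (a i) (tau i)).
by rewrite aa subrr subr0 subr_ge0.
Qed.

(** Coordinates of the [t]-th tensor power of [x], indexed by words of length [t]. *)
Definition tpow (R : realType) (T : finType) (t : nat) (x : T -> R)
  (I : {ffun 'I_t -> T}) : R := \prod_(r < t) x (I r).

Arguments tpow {R T} t x I.

(** Expanding a product of [t] equal sums yields a sum over words. This turns powers of inner
    products, hence [K_t], into inner products of tensors. *)
Lemma dot_tpow (R : realType) (T : finType) (t : nat) (x y : T -> R) :
  dot (tpow t x) (tpow t y) = dot x y ^+ t.
Proof.
transitivity (\prod_(r < t) dot x y); last by rewrite prodr_const card_ord.
by rewrite /dot bigA_distr_bigA; apply: eq_bigr => I _; rewrite -big_split.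
Qed.

Lemma tpow_scale (R : realType) (T : finType) (t : nat) (c : R) (x : T -> R) :
  tpow t (fun i => c * x i) = (fun I => c ^+ t * tpow t x I).
Proof.
by apply/funext => I; rewrite /tpow big_split /= prodr_const card_ord.
Qed.

Lemma tpow0 (R : realType) (T : finType) (t : nat) :
  (0 < t)%N -> tpow t (fun _ : T => 0 : R) = (fun=> 0).
Proof.
by move=> t0; apply/funext => I; rewrite /tpow prodr_const card_ord expr0n gtn_eqF.
Qed.

(** * Functions polynomial in each coordinate *)

(** Separate polynomiality is what spreads vanishing from integral points one variable at a time,
    with univariate polynomials only. *)
Definition coordinatewise_poly (R : realType) (d : nat) (N : ('I_d -> R) -> R) :=
  forall (i : 'I_d) (z : 'I_d -> R), exists p : {poly R},
    forall u, N (fun l => if l == i then u else z l) = p.[u].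

Lemma cpoly_cst (R : realType) (d : nat) (c : R) :
  coordinatewise_poly (fun _ : 'I_d -> R => c).
Proof. by move=> i z; exists c%:P => u; rewrite hornerC. Qed.

Lemma cpoly_coord (R : realType) (d : nat) (l : 'I_d) :
  coordinatewise_poly (fun z : 'I_d -> R => z l).
Proof.
move=> i z; case: (eqVneq l i) => [|_]; first by exists 'X => u; rewrite hornerX.
by exists (z l)%:P => u; rewrite hornerC.
Qed.

Lemma cpoly_add (R : realType) (d : nat) (M N : ('I_d -> R) -> R) :
  coordinatewise_poly M -> coordinatewise_poly N ->
  coordinatewise_poly (fun z => M z + N z).
Proof.
move=> hM hN i z; have [p hp] := hM i z; have [q hq] := hN i z.
by exists (p + q) => u; rewrite hornerD hp hq.
Qed.

Lemma cpoly_mul (R : realType) (d : nat) (M N : ('I_d -> R) -> R) :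
  coordinatewise_poly M -> coordinatewise_poly N ->
  coordinatewise_poly (fun z => M z * N z).
Proof.
move=> hM hN i z; have [p hp] := hM i z; have [q hq] := hN i z.
by exists (p * q) => u; rewrite hornerM hp hq.
Qed.

Lemma cpoly_sum (R : realType) (d : nat) (I : Type) (r : seq I)
  (M : I -> ('I_d -> R) -> R) : (forall j, coordinatewise_poly (M j)) ->
  coordinatewise_poly (fun z => \sum_(j <- r) M j z).
Proof.
move=> hM; elim: r => [|j r IH].
  have -> : (fun z => \sum_(j <- [::]) M j z) = (fun=> 0).
    by apply/funext => z; rewrite big_nil.
  exact: cpoly_cst.
have -> : (fun z => \sum_(i <- j :: r) M i z) =
  (fun z => M j z + \sum_(i <- r) M i z).
  by apply/funext => z; rewrite big_cons.
exact: cpoly_add.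
Qed.

Lemma cpoly_prod (R : realType) (d : nat) (I : Type) (r : seq I)
  (M : I -> ('I_d -> R) -> R) : (forall j, coordinatewise_poly (M j)) ->
  coordinatewise_poly (fun z => \prod_(j <- r) M j z).
Proof.
move=> hM; elim: r => [|j r IH].
  have -> : (fun z => \prod_(j <- [::]) M j z) = (fun=> 1).
    by apply/funext => z; rewrite big_nil.
  exact: cpoly_cst.
have -> : (fun z => \prod_(i <- j :: r) M i z) =
  (fun z => M j z * \prod_(i <- r) M i z).
  by apply/funext => z; rewrite big_cons.
exact: cpoly_mul.
Qed.

Lemma cpoly_vanish (R : realType) (d : nat) (N : ('I_d -> R) -> R) :
  coordinatewise_poly N ->
  (forall z : {ffun 'I_d -> nat}, N (fun i => (z i)%:R) = 0) ->
  forall z, N z = 0.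
Proof.
move=> hN N0 z.
(* Induction on the number [m] of leading coordinates allowed to be arbitrary reals, the others
   staying integral. *)
suff H m : (m <= d)%N -> forall y : 'I_d -> R,
    (forall i : 'I_d, (m <= i)%N -> exists n : nat, y i = n%:R) -> N y = 0.
  by apply: (H d) => // i; rewrite leqNgt ltn_ord.
elim: m => [_ y hy|m IH md y hy].
  have /choice[n hn] : forall i, exists n : nat, y i = n%:R by move=> i; apply: hy.
  rewrite -(N0 [ffun i => n i]); congr N; apply/funext => i.
  by rewrite ffunE hn.
pose i := Ordinal md; have [p hp] := hN i y.
have py u : (fun l => if l == i then u else y l) = y -> N y = p.[u] by move <-.
suff p0 : p = 0 by rewrite (py (y i)) ?p0 ?horner0 //;
  apply/funext => l; case: eqP => [->|].
apply/eqP/negPn/negP => pn0.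
(* The integers below [size p] would be [size p] distinct roots of a nonzero [p], one more than its
   degree permits. *)
have := @max_poly_roots _ p [seq (n%:R : R) | n <- iota 0 (size p)] pn0.
rewrite size_map size_iota ltnn => H; suff : false by [].
apply: H; last first.
  rewrite map_inj_uniq ?iota_uniq //; exact: mulrIn (oner_neq0 R).
apply/allP => _ /mapP[n _ ->]; apply/eqP; rewrite -hp.
apply: (IH (ltnW md)) => l ml; case: (eqVneq l i) => [_|li]; first by exists n.
by apply: hy; rewrite ltn_neqAle ml andbT; apply: contraNneq li => ml'; apply/eqP/val_inj.
Qed.

(** * Expectations of finite sums *)

Lemma expectation_Rintegral (R : realType) (dT : measure_display)
  (T : measurableType dT) (Pr : probability T R) (f : T -> R) :
  Pr.-integrable setT (EFin \o f) ->
  ('E_Pr[f] = (\int[Pr]_x f x)%:E)%E.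
Proof. by move=> fi; rewrite unlock /Rintegral fineK // integrable_fin_num. Qed.

Lemma integrable_lincomb (R : realType) (dT : measure_display)
  (T : measurableType dT) (Pr : probability T R) (I : Type) (r : seq I)
  (P : pred I) (a : I -> R) (F : I -> T -> R) :
  (forall i, P i -> Pr.-integrable setT (EFin \o F i)) ->
  Pr.-integrable setT (EFin \o (fun x => \sum_(i <- r | P i) a i * F i x)) /\
  \int[Pr]_x (\sum_(i <- r | P i) a i * F i x) =
  \sum_(i <- r | P i) a i * \int[Pr]_x F i x.
Proof.
move=> Fi; elim: r => [|i r [IH1 IH2]].
  have -> : (fun x => \sum_(i <- [::] | P i) a i * F i x) = cst 0.
    by apply/funext => x; rewrite big_nil.
  split; first exact: finite_measure_integrable_cst.
  by rewrite Rintegral_cst // mul0r big_nil.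
have [Pi|Pi] := boolP (P i); last first.
  have -> : (fun x => \sum_(j <- i :: r | P j) a j * F j x) =
      (fun x => \sum_(j <- r | P j) a j * F j x).
    by apply/funext => x; rewrite big_cons (negbTE Pi).
  by rewrite big_cons (negbTE Pi).
have -> : (fun x => \sum_(j <- i :: r | P j) a j * F j x) =
    (fun x => a i * F i x + \sum_(j <- r | P j) a j * F j x).
  by apply/funext => x; rewrite big_cons Pi.
have aFi : Pr.-integrable setT (EFin \o (fun x => a i * F i x)).
  exact: (integrableZl measurableT (a i) (Fi i Pi)).
split; first exact: (integrableD measurableT aFi IH1).
by rewrite RintegralD // RintegralZl // ?IH2 ?big_cons ?Pi //; exact: Fi.
Qed.

Lemma integrable_dominated (R : realType) (dT : measure_display)
  (T : measurableType dT) (Pr : probability T R) (f g : T -> R) :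
  measurable_fun setT f -> (forall x, `|f x| <= g x) ->
  Pr.-integrable setT (EFin \o g) -> Pr.-integrable setT (EFin \o f).
Proof.
move=> mf fg; apply: le_integrable => //; first exact/measurable_EFinP.
by move=> x _ /=; rewrite lee_fin (le_trans (fg x)) // ler_norm.
Qed.

(** * Projections, tensor powers and reflections *)

Lemma mxv_mul (R : realType) (d : nat) (A B : 'M[R]_d) (x : 'I_d -> R) :
  mxv (A *m B) x = mxv A (mxv B x).
Proof.
apply/funext => i; rewrite /mxv.
under eq_bigr do rewrite mxE mulr_suml.
rewrite exchange_big; apply: eq_bigr => l _; rewrite mulr_sumr.
by apply: eq_bigr => j _; rewrite mulrA.
Qed.

Lemma mxv1 (R : realType) (d : nat) (x : 'I_d -> R) : mxv 1%:M x = x.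
Proof.
apply/funext => i; rewrite /mxv (bigD1 i) //= mxE eqxx mul1r big1 ?addr0 // => j.
by rewrite mxE eq_sym => /negbTE ->; rewrite mul0r.
Qed.

Lemma dot_mxv (R : realType) (d : nat) (P : 'M[R]_d) (x y : 'I_d -> R) :
  dot x (mxv P y) = dot (mxv P^T x) y.
Proof.
rewrite /dot /mxv; under eq_bigr do rewrite mulr_sumr.
rewrite exchange_big; apply: eq_bigr => l _; rewrite mulr_suml.
by apply: eq_bigr => j _; rewrite mxE mulrCA mulrA.
Qed.

Lemma dot_mxv_grass (R : realType) (k d : nat) (P : 'M[R]_d) (x y : 'I_d -> R) :
  grass k P -> dot (mxv P x) (mxv P y) = dot x (mxv P y).
Proof.
by move=> [Ps [Pi _]]; rewrite dot_mxv -mxv_mul Ps Pi [RHS]dot_mxv Ps.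
Qed.

(** A diagonal entry [P i i] is the squared norm of the [i]-th row, so it dominates every
    [P i j ^+ 2]; taking [j = i] shows that it is at most 1. *)
Lemma grass_entry_le1 (R : realType) (k d : nat) (P : 'M[R]_d) (i j : 'I_d) :
  grass k P -> `|P i j| <= 1.
Proof.
move=> [Ps [Pi _]].
have Psq i' : P i' i' = \sum_l P i' l ^+ 2.
  rewrite -{1}Pi mxE; apply: eq_bigr => l _.
  by rewrite expr2 -{2}Ps mxE.
have le_diag i' j' : P i' j' ^+ 2 <= P i' i'.
  rewrite (Psq i') (bigD1 j') //= lerDl sumr_ge0 // => l _; exact: sqr_ge0.
have Pii0 : 0 <= P i i by apply: le_trans (le_diag i i); exact: sqr_ge0.
have Pii : P i i <= 1.
  rewrite leNgt; apply/negP => P1; have := le_diag i i.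
  by rewrite expr2 -[leRHS]mul1r ler_pM2r ?leNgt ?P1 // (lt_trans ltr01).
rewrite -(@ler_pXn2r _ 2) ?nnegrE // expr1n real_normK ?num_real //.
exact: le_trans Pii.
Qed.

(* The [t]-fold tensor power of [P] acting on tensors indexed by words. *)
Definition tmx (R : realType) (d t : nat) (P : 'M[R]_d)
  (u : {ffun 'I_t -> 'I_d} -> R) : {ffun 'I_t -> 'I_d} -> R :=
  fun I => dot (fun J : {ffun 'I_t -> 'I_d} => \prod_(r < t) P (I r) (J r)) u.

Lemma tmx_tpow (R : realType) (d t : nat) (P : 'M[R]_d) (x : 'I_d -> R) :
  tmx P (tpow t x) = tpow t (mxv P x).
Proof.
apply/funext => I; rewrite /tmx /dot /tpow /mxv bigA_distr_bigA.
by apply: eq_bigr => J _; rewrite -big_split.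
Qed.

Lemma tmx_lincomb (R : realType) (d t m : nat) (P : 'M[R]_d) (c : 'I_m -> R)
  (v : 'I_m -> {ffun 'I_t -> 'I_d} -> R) :
  tmx P (lincomb c v) = lincomb c (fun l => tmx P (v l)).
Proof.
apply/funext => I; rewrite /tmx dotC dot_lincomb.
by apply: eq_bigr => l _; rewrite dotC.
Qed.

(** The quadratic form of the tensor power of [P] at a fixed [s], as a function of [P]: a continuous
    test function for the invariance of the law. *)
Definition tform (R : realType) (d t : nat) (s : {ffun 'I_t -> 'I_d} -> R)
  (P : 'M[R]_d) : R := dot s (tmx P s).

Lemma tform_continuous (R : realType) (d t : nat)
  (s : {ffun 'I_t -> 'I_d} -> R) : continuous (tform s).
Proof.
apply: continuous_big; first exact: add_continuous.
move=> I _ P; apply: continuousM; first exact: cst_continuous.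
move: P; apply: continuous_big; first exact: add_continuous.
move=> J _ P; apply: continuousM; last exact: cst_continuous.
move: P; apply: continuous_big; first exact: mul_continuous.
by move=> r _; exact: coord_continuous.
Qed.

Lemma tform_measurable (R : realType) (d t : nat) (dT : measure_display)
  (T : measurableType dT) (Q : T -> 'M[R]_d) (s : {ffun 'I_t -> 'I_d} -> R) :
  (forall i j, measurable_fun setT (fun w => Q w i j)) ->
  measurable_fun setT (fun w => tform s (Q w)).
Proof.
move=> mQ; apply: measurable_sum => I; apply: measurable_funM => //.
apply: measurable_sum => J; apply: measurable_funM => //.
by apply: measurable_prod => r _; exact: mQ.
Qed.

Definition is_tpow (R : realType) (T : finType) (t : nat)
  (u : {ffun 'I_t -> T} -> R) : Prop := exists x, u = tpow t x.

Lemma in_span_tpow (R : realType) (T : finType) (t : nat)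
  (s : {ffun 'I_t -> T} -> R) : in_span (@is_tpow R T t) s ->
  exists (m : nat) (c : 'I_m -> R) (x : 'I_m -> T -> R),
    s = lincomb c (fun l => tpow t (x l)).
Proof.
move=> [m [c [v [/choice[x hx] ->]]]]; exists m, c, x.
by congr lincomb; apply/funext.
Qed.

(** The tensor power of an orthogonal projection is again an orthogonal projection; by bilinearity
    this is checked on tensor powers of vectors. In particular the form is nonnegative. *)
Lemma tform_grass (R : realType) (k d t : nat) (P : 'M[R]_d)
  (s : {ffun 'I_t -> 'I_d} -> R) : grass k P -> in_span (@is_tpow R _ t) s ->
  tform s P = dot (tmx P s) (tmx P s).
Proof.
move=> gP /in_span_tpow[m [c [x ->]]].
rewrite /tform tmx_lincomb !dot_lincomb.
apply: eq_bigr => l _; congr (_ * _); rewrite ![dot _ (lincomb _ _)]dotC.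
rewrite !dot_lincomb; apply: eq_bigr => l' _; congr (_ * _).
by rewrite !tmx_tpow !dot_tpow (dot_mxv_grass _ _ gP) dot_mxv; case: gP => ->.
Qed.

(** The form is the squared norm of [tmx P s], so [tmx P s] is zero; by self-adjointness [s] is then
    orthogonal to the tensor power of any vector in the range of [P]. *)
Lemma tform_eq0 (R : realType) (k d t : nat) (P : 'M[R]_d)
  (s : {ffun 'I_t -> 'I_d} -> R) (y : 'I_d -> R) :
  grass k P -> in_span (@is_tpow R _ t) s ->
  tform s P = 0 -> dot s (tpow t (mxv P y)) = 0.
Proof.
move=> gP sS; rewrite (tform_grass gP sS) => /dot_eq0 s0.
transitivity (dot (tmx P s) (tpow t y)).
  have [m [c [x ->]]] := in_span_tpow sS.
  rewrite tmx_lincomb !dot_lincomb; apply: eq_bigr => l _.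
  by rewrite tmx_tpow !dot_tpow dot_mxv; case: gP => ->.
by rewrite s0 /dot big1 // => I _; rewrite mul0r.
Qed.

Lemma dotBZ (R : realType) (T : finType) (a : R) (z u v : T -> R) :
  dot z (fun i => u i - a * v i) = dot z u - a * dot z v.
Proof.
by rewrite /dot mulr_sumr -sumrB; apply: eq_bigr => i _; rewrite mulrBr mulrCA.
Qed.

(* For [z = 0] the convention [0^-1 = 0] makes this the identity. *)
Definition refl_mx (R : realType) (d : nat) (z : 'I_d -> R) : 'M[R]_d :=
  \matrix_(i, j) ((i == j)%:R - 2 / dot z z * (z i * z j)).

Lemma refl_mx_tr (R : realType) (d : nat) (z : 'I_d -> R) :
  (refl_mx z)^T = refl_mx z.
Proof. by apply/matrixP => i j; rewrite !mxE eq_sym (mulrC (z j)). Qed.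

Lemma mxv_refl (R : realType) (d : nat) (z v : 'I_d -> R) :
  mxv (refl_mx z) v = (fun i => v i - 2 / dot z z * dot z v * z i).
Proof.
apply/funext => i; rewrite /mxv.
under eq_bigr do rewrite mxE mulrBl.
rewrite sumrB; congr (_ - _).
  rewrite (bigD1 i) //= eqxx mul1r big1 ?addr0 // => j.
  by rewrite eq_sym => /negbTE ->; rewrite mul0r.
rewrite /dot mulr_sumr mulr_suml; apply: eq_bigr => j _; ring.
Qed.

Lemma refl_mxK (R : realType) (d : nat) (z : 'I_d -> R) :
  refl_mx z *m refl_mx z = 1%:M.
Proof.
suff E v : mxv (refl_mx z) (mxv (refl_mx z) v) = v.
  apply/matrixP => i j.
  have := congr1 (fun f => f i) (E (fun l => (l == j)%:R)).
  rewrite -mxv_mul /mxv (bigD1 j) //= eqxx mulr1 big1 ?addr0 => [->|l /negbTE ->].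
    by rewrite mxE.
  by rewrite mulr0.
rewrite !mxv_refl; apply/funext => i.
have [z0|z0] := eqVneq (dot z z) 0.
  by rewrite z0 invr0 mulr0 !mul0r !subr0.
have -> : dot z (fun i => v i - 2 / dot z z * dot z v * z i) = - dot z v.
  by rewrite dotBZ; field.
by field.
Qed.

Lemma grass_conj (R : realType) (k d : nat) (O P : 'M[R]_d) :
  O^T *m O = 1%:M -> grass k P -> grass k (O *m P *m O^T).
Proof.
move=> OO [Ps [Pi Pt]]; split; first by rewrite !trmx_mul trmxK Ps mulmxA.
split; last by rewrite mxtrace_mulC mulmxA OO mul1mx.
by rewrite !mulmxA -(mulmxA (O *m P)) OO mulmx1 -(mulmxA O) Pi.
Qed.

(** The positive trace makes [P] nonzero, and idempotence fixes each of its columns. *)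
Lemma grass_fixed (R : realType) (k d : nat) (P : 'M[R]_d) :
  (0 < k)%N -> grass k P -> exists v, mxv P v = v /\ dot v v != 0.
Proof.
move=> k0 [_ [Pi Pt]].
have [i [j Pij]] : exists i j, P i j != 0.
  apply: contrapT => H; move: Pt; have -> : P = 0.
    apply/matrixP => i j; rewrite mxE; apply/eqP/negPn/negP => Pij.
    by apply: H; exists i, j.
  by rewrite mxtrace0 => /eqP; rewrite eq_sym pnatr_eq0 eqn0Ngt k0.
exists (fun l => P l j); split.
  by apply/funext => l; rewrite /mxv -{3}Pi mxE.
apply: contraNneq Pij => /dot_eq0 /(congr1 (fun f => f i)) /= ->.
by [].
Qed.

(* A reflection in [z = v - y] carries [v] to [y]; clearing the denominator
   makes the image of [v] polynomial in [z], so that it is enough to know the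
   vanishing for the countably many integral [z]. *)
Lemma dot_tpow_vanish (R : realType) (d t : nat)
  (s : {ffun 'I_t -> 'I_d} -> R) (v : 'I_d -> R) :
  (0 < t)%N -> dot v v != 0 ->
  (forall z : {ffun 'I_d -> nat},
     dot s (tpow t (mxv (refl_mx (fun i => (z i)%:R)) v)) = 0) ->
  forall y, dot s (tpow t y) = 0.
Proof.
move=> t0 v0 H.
pose N z := dot s (tpow t (fun i => dot z z * v i - 2 * dot z v * z i)).
have dotZ c y : dot s (tpow t (fun i => c * y i)) = c ^+ t * dot s (tpow t y).
  by rewrite tpow_scale /dot mulr_sumr; apply: eq_bigr => I _; rewrite mulrCA.
have NE z : N z = dot z z ^+ t * dot s (tpow t (mxv (refl_mx z) v)).
  rewrite -dotZ mxv_refl /N; congr (dot s (tpow t _)); apply/funext => i.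
  have [z0|z0] := eqVneq (dot z z) 0; last by field.
  by rewrite z0 (dot_eq0 z0) !mul0r mulr0 subr0.
have N0 : forall z, N z = 0.
  apply: cpoly_vanish => [|z]; last by rewrite NE H mulr0.
  have cdot u : coordinatewise_poly (fun z : 'I_d -> R => dot z u).
    by apply: cpoly_sum => i; apply: cpoly_mul; [apply: cpoly_coord|apply: cpoly_cst].
  apply: cpoly_sum => I; apply: cpoly_mul; first exact: cpoly_cst.
  apply: cpoly_prod => r.
  have -> : (fun z => dot z z * v (I r) - 2 * dot z v * z (I r)) =
    (fun z => dot z z * v (I r) + (- 2) * dot z v * z (I r)).
    by apply/funext => z; rewrite !mulNr.
  apply: cpoly_add; apply: cpoly_mul; try exact: cpoly_cst.
  - apply: cpoly_sum => i; apply: cpoly_mul; exact: cpoly_coord.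
  - by apply: cpoly_mul; [apply: cpoly_cst|apply: cdot].
  - exact: cpoly_coord.
have sphere y : dot y y = dot v v -> dot s (tpow t y) = 0.
  move=> yv; pose z i := v i - y i.
  (* Equal norms of [v] and [y] give this relation; with it the cleared image of [v] in [N z]
     becomes [dot z z] times [y]. *)
  have zz : dot z z = 2 * dot z v.
    transitivity (2 * dot z v + (dot y y - dot v v)); last by rewrite yv subrr addr0.
    by rewrite /dot mulr_sumr -sumrB -big_split; apply: eq_bigr => i _; rewrite /z /=; ring.
  have [z0|z0] := eqVneq (dot z z) 0.
    (* Here [y = v], and the integral vector zero gives the identity as its reflection. *)
    have <- : mxv (refl_mx (fun i => ([ffun=> 0%N] i)%:R)) v = y.
      rewrite mxv_refl; apply/funext => i; rewrite ffunE mulr0 subr0.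
      by have /= := congr1 (fun f => f i) (dot_eq0 z0) => /eqP; rewrite subr_eq0 => /eqP.
    exact: H.
  have := N0 z; rewrite /N.
  have -> : (fun i => dot z z * v i - 2 * dot z v * z i) = (fun i => dot z z * y i).
    by apply/funext => i; rewrite -zz /z; ring.
  rewrite dotZ => /eqP; rewrite mulf_eq0 expf_eq0 t0 (negbTE z0) => /eqP; exact.
move=> y; have [y0|y0] := eqVneq (dot y y) 0.
  by rewrite (dot_eq0 y0) tpow0 // /dot big1 // => I _; rewrite mulr0.
(* Rescales [y] to the norm of [v]; homogeneity of degree [t] transports the vanishing back. *)
pose c := Num.sqrt (dot v v / dot y y).
have c2 : c ^+ 2 = dot v v / dot y y by rewrite sqr_sqrtr // divr_ge0 ?dot_ge0.
have c0 : c != 0.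
  apply: contraNneq v0 => c0; move: c2; rewrite c0 expr0n /= => /esym/eqP.
  by rewrite mulf_eq0 invr_eq0 (negbTE y0) orbF.
have := sphere (fun i => c * y i).
have -> : dot (fun i => c * y i) (fun i => c * y i) = dot v v.
  transitivity (c ^+ 2 * dot y y); last by rewrite c2 divfK.
  by rewrite /dot mulr_sumr; apply: eq_bigr => i _; ring.
move=> /(_ erefl) /eqP; rewrite dotZ mulf_eq0 expf_eq0 t0 (negbTE c0) => /eqP; exact.
Qed.

(** * Inverting the mean tensor power *)

Lemma ae_exists (R : realType) (dT : measure_display)
  (T : measurableType dT) (Pr : probability T R) (P : T -> Prop) :
  (\forall x \ae Pr, P x) -> exists x, P x.
Proof.
have Pr0 : (0 < Pr setT)%E by rewrite probability_setT.
have pf : ProperFilter (almost_everywhere Pr).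
  exact: ae_properfilter_algebraOfSetsType Pr0.
exact: (@filter_ex _ _ pf).
Qed.

(** A nonnegative function of mean zero vanishes almost surely. By invariance this holds for the
    conjugates of [Q] by all integral reflections; these being countably many, a single outcome [w]
    serves them all. The reflected images of a vector fixed by [Q w] then make [s] orthogonal to
    every tensor power, hence to itself. *)
Lemma grass_law_tform_eq0 (R : realType) (k d t : nat) (dS : measure_display)
  (TS : measurableType dS) (PS : probability TS R) (Q : TS -> 'M[R]_d)
  (s : {ffun 'I_t -> 'I_d} -> R) :
  (0 < k)%N -> (0 < t)%N -> grass_law k PS Q -> in_span (@is_tpow R _ t) s ->
  ('E_PS[fun w => tform s (Q w)] = 0)%E -> s = (fun=> 0).
Proof.
move=> k0 t0 [mQ [gQ invQ]] sS E0.
pose O (z : {ffun 'I_d -> nat}) : 'M[R]_d := refl_mx (fun i => (z i)%:R).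
have OO z : (O z)^T *m O z = 1%:M by rewrite refl_mx_tr refl_mxK.
have gOQ z w : grass k (O z *m Q w *m (O z)^T) by apply: grass_conj.
have ae0 z : \forall w \ae PS, tform s (O z *m Q w *m (O z)^T) = 0.
  have mOQ i j : measurable_fun setT (fun w => (O z *m Q w *m (O z)^T) i j).
    have -> : (fun w => (O z *m Q w *m (O z)^T) i j) =
      (fun w => \sum_l (\sum_m O z i m * Q w m l) * O z j l).
      by apply/funext => w; rewrite mxE; apply: eq_bigr => l _; rewrite !mxE.
    apply: measurable_sum => l; apply: measurable_funM => //.
    by apply: measurable_sum => m; apply: measurable_funM.
  have mf := tform_measurable s mOQ.
  have mE : measurable_fun setT
      (fun w => (tform s (O z *m Q w *m (O z)^T))%:E) by exact/measurable_EFinP.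
  have [H _] := ae_eq_integral_abs PS measurableT mE.
  apply: filterS (H _) => [w /(_ I)[]//|].
  rewrite -E0 -(invQ (O z) (OO z) _ (@tform_continuous R d t s)) unlock.
  apply: eq_integral => w _; rewrite gee0_abs // lee_fin.
  by rewrite (tform_grass (gOQ z w) sS) dot_ge0.
(* The reflections are enumerated through [unpickle], so that the null sets form a sequence; codes
   of no vector carry the condition [True]. *)
have : \forall w \ae PS, forall n, 
  if unpickle n is Some z then tform s (O z *m Q w *m (O z)^T) = 0 else True.
  apply/ae_foralln => n; case: (unpickle n) => [z|]; first exact: ae0.
  exact: aeW.
move=> /ae_exists[w hw].
have [v [Qv v0]] := grass_fixed k0 (gQ w).
have s0 := dot_tpow_vanish t0 v0 (s := s).
suff H : dot s s = 0 by apply: dot_eq0.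
have [m [c [x sE]]] := in_span_tpow sS.
rewrite {1}sE dot_lincomb big1 // => l _; rewrite dotC s0 ?mulr0 // => z.
rewrite -/(O z).
(* The vector [mxv (O z) v] is fixed by the conjugated projection, because [v] is fixed by [Q w]. *)
have := hw (pickle z); rewrite pickleK => /(tform_eq0 (mxv (O z) v) (gOQ z w) sS).
rewrite !mxv_mul -(mxv_mul (O z)^T) OO mxv1 Qv; exact.
Qed.

Lemma prod_entries_integrable (R : realType) (k d t : nat) (dS : measure_display)
  (TS : measurableType dS) (PS : probability TS R) (Q : TS -> 'M[R]_d)
  (I J : 'I_t -> 'I_d) :
  grass_law k PS Q ->
  PS.-integrable setT (EFin \o (fun w => \prod_(r < t) Q w (I r) (J r))).
Proof.
move=> [mQ [gQ _]]; apply: (integrable_dominated (g := cst 1)).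
- by apply: measurable_prod => r _; exact: mQ.
- move=> w; rewrite normr_prod; apply: prodr_ile1 => r _.
  by rewrite normr_ge0 (grass_entry_le1 _ _ (gQ w)).
- exact: finite_measure_integrable_cst.
Qed.

(** The matrix entries of the mean of the [t]-fold tensor power of [Q]. *)
Definition tmean (R : realType) (d t : nat) (dS : measure_display)
  (TS : measurableType dS) (PS : probability TS R) (Q : TS -> 'M[R]_d)
  (I J : {ffun 'I_t -> 'I_d}) : R :=
  \int[PS]_w (\prod_(r < t) Q w (I r) (J r)).

Lemma dot_tmx_mean (R : realType) (k d t : nat) (dS : measure_display)
  (TS : measurableType dS) (PS : probability TS R) (Q : TS -> 'M[R]_d)
  (s u : {ffun 'I_t -> 'I_d} -> R) : grass_law k PS Q ->
  PS.-integrable setT (EFin \o (fun w => dot s (tmx (Q w) u))) /\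
  \int[PS]_w dot s (tmx (Q w) u) = dot s (fun I => dot (tmean PS Q I) u).
Proof.
move=> lawQ.
have H1 (I : {ffun 'I_t -> 'I_d}) :
    PS.-integrable setT (EFin \o (fun w => tmx (Q w) u I)) /\
    \int[PS]_w tmx (Q w) u I = dot (tmean PS Q I) u.
  have -> : (fun w => tmx (Q w) u I) = (fun w =>
      \sum_(J : {ffun 'I_t -> 'I_d}) u J * \prod_(r < t) Q w (I r) (J r)).
    by apply/funext => w; apply: eq_bigr => J _; rewrite mulrC.
  rewrite dotC; apply: integrable_lincomb => J _.
  exact: prod_entries_integrable lawQ.
have [h1 h2] := integrable_lincomb (index_enum _) (P := xpredT) s (fun I _ => (H1 I).1).
split; first exact: h1.
by rewrite [LHS]h2; apply: eq_bigr => I _; rewrite (H1 I).2.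
Qed.

(** The form [tmean] has no nonzero isotropic vector in the span of tensor powers, so [solve_span]
    inverts it; evaluating at [tpow t x] turns it into an average over [Q]. *)
Lemma moment_reconstruction (R : realType) (k d t : nat) (dS : measure_display)
  (TS : measurableType dS) (PS : probability TS R) (Q : TS -> 'M[R]_d)
  (tau : {ffun 'I_t -> 'I_d} -> R) :
  (0 < k)%N -> (0 < t)%N -> grass_law k PS Q ->
  exists a, in_span (@is_tpow R _ t) a /\ forall x,
    \int[PS]_w dot a (tpow t (mxv (Q w) x)) = dot tau (tpow t x).
Proof.
move=> k0 t0 lawQ.
have [s sS s0|a [aS ha]] := @solve_span R _ (@is_tpow R 'I_d t) (tmean PS Q) _ tau.
  apply: (grass_law_tform_eq0 k0 t0 lawQ sS).
  have [h1 h2] := dot_tmx_mean s s lawQ.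
  by rewrite expectation_Rintegral // h2 s0.
exists a; split => // x; rewrite -ha; last by exists x.
rewrite -(dot_tmx_mean _ _ lawQ).2; apply: eq_Rintegral => w _.
by rewrite tmx_tpow.
Qed.

Lemma integrable_dot_tpow (R : realType) (k d t : nat) (dS : measure_display)
  (TS : measurableType dS) (PS : probability TS R) (Q : TS -> 'M[R]_d)
  (a : {ffun 'I_t -> 'I_d} -> R) (x : 'I_d -> R) : grass_law k PS Q ->
  PS.-integrable setT (EFin \o (fun w => dot a (tpow t (mxv (Q w) x)))).
Proof.
move=> lawQ; have [h _] := dot_tmx_mean a (tpow t x) lawQ.
by apply: eq_integrable h => // w _ /=; rewrite tmx_tpow.
Qed.

(** * Membership in the test spaces of exact cubatures *)

Lemma hsprod_outer (R : realType) (d : nat) (u v : 'I_d -> R) (P : 'M[R]_d) :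
  hsprod ((\col_i u i) *m (\row_i v i)) P = dot v (mxv P u).
Proof.
rewrite /hsprod -mulmxA mxtrace_mulC trace_mx11 -mulmxA mxE.
apply: eq_bigr => i _; rewrite !mxE; congr (_ * _).
by apply: eq_bigr => j _; rewrite mxE.
Qed.

Lemma in_PolL_dot_tpow (R : realType) (l k d t : nat)
  (a : {ffun 'I_t -> 'I_d} -> R) (x : 'I_d -> R) : (2 <= l)%N ->
  in_span (@is_tpow R _ t) a ->
  in_PolL l t k (fun P => dot a (tpow t (mxv P x))).
Proof.
move=> l2 /in_span_tpow[m [c [z ->]]].
(* The symmetric part of the outer product of [z i] and [x], of rank at most 2; its two halves pair
   equally with [P], which is symmetric. *)
pose M i : 'M[R]_d := (\col_j z i j) *m (\row_j (2^-1 * x j)) +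
  (\col_j x j) *m (\row_j (2^-1 * z i j)).
exists m, c, M, (fun=> t); split => [i|P gP].
  split; first by apply/matrixP => p q; rewrite !mxE !big_ord1 !mxE; ring.
  split => //; apply: leq_trans l2; apply: leq_trans (mxrank_add _ _) _.
  by rewrite (@leq_add _ _ 1 1) // mulmx_max_rank.
rewrite dot_lincomb; apply: eq_bigr => i _; rewrite dot_tpow; congr (_ * _ ^+ _).
have half u v : dot (fun j => 2^-1 * u j) v = 2^-1 * dot u v.
  by rewrite /dot mulr_sumr; apply: eq_bigr => j _; rewrite mulrA.
rewrite /hsprod mulmxDl mxtraceD -/(hsprod _ _) -/(hsprod _ _) !hsprod_outer !half.
have -> : dot x (mxv P (z i)) = dot (z i) (mxv P x).
  by rewrite dot_mxv dotC; case: gP => ->.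
by field.
Qed.

(** * The error bound for approximate cubatures *)

(** Flattening a matrix makes the trace product with a symmetric matrix a [dot], so that [tpow t] of
    the result is a feature map of the kernel [K_t]. *)
Definition pairv (R : realType) (d : nat) (P : 'M[R]_d) : 'I_d * 'I_d -> R :=
  fun p => P p.1 p.2.

Definition outer (R : realType) (d : nat) (u v : 'I_d -> R) : 'I_d * 'I_d -> R :=
  fun p => u p.1 * v p.2.

Lemma dot_outer_pairv (R : realType) (d : nat) (u v : 'I_d -> R) (P : 'M[R]_d) :
  dot (outer u v) (pairv P) = dot u (mxv P v).
Proof.
rewrite /dot /mxv -(pair_bigA _ (fun i j => u i * v j * P i j)).
apply: eq_bigr => i _; rewrite mulr_sumr; apply: eq_bigr => j _.
by rewrite -mulrA (mulrC (v j)).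
Qed.

Lemma dot_outer (R : realType) (d : nat) (u v u' v' : 'I_d -> R) :
  dot (outer u v) (outer u' v') = dot u u' * dot v v'.
Proof.
rewrite /dot -(pair_bigA _ (fun i j => u i * v j * (u' i * v' j))) mulr_suml.
apply: eq_bigr => i _; rewrite mulr_sumr; apply: eq_bigr => j _.
by rewrite mulrACA.
Qed.

Lemma hsprod_pairv (R : realType) (d : nat) (A B : 'M[R]_d) : B^T = B ->
  hsprod A B = dot (pairv A) (pairv B).
Proof.
move=> Bs; rewrite /dot -(pair_bigA _ (fun i j => A i j * B i j)).
apply: eq_bigr => i _; rewrite mxE; apply: eq_bigr => j _.
by rewrite -{1}Bs mxE.
Qed.

(** A kernel combination is the pairing with a tensor in the span of the tensor powers of its nodes;
    the next lemma identifies its kernel norm with the Euclidean norm of that tensor. *)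
Lemma Kt_fun_dot (R : realType) (k d t m : nat) (c : 'I_m -> R)
  (Qs : 'I_m -> 'M[R]_d) (P : 'M[R]_d) : grass k P ->
  Kt_fun t c Qs P = dot (lincomb c (fun l => tpow t (pairv (Qs l)))) (tpow t (pairv P)).
Proof.
move=> [Ps _]; rewrite dot_lincomb; apply: eq_bigr => i _.
by rewrite dot_tpow hsprod_pairv.
Qed.

Lemma Kt_norm2_dot (R : realType) (k d t m : nat) (c : 'I_m -> R)
  (Qs : 'I_m -> 'M[R]_d) : (forall i, grass k (Qs i)) ->
  Kt_norm2 t c Qs = dot (lincomb c (fun l => tpow t (pairv (Qs l))))
    (lincomb c (fun l => tpow t (pairv (Qs l)))).
Proof.
move=> gQs; rewrite dot_lincomb; apply: eq_bigr => i _.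
rewrite dotC dot_lincomb mulr_sumr; apply: eq_bigr => j _.
by rewrite dotC dot_tpow hsprod_pairv ?mulrA //; case: (gQs j).
Qed.

(** A test function of norm 1 exists: [K_t] at a point [Q w0] of the Grassmannian, rescaled, since
    [K_t] takes the positive value [k ^ t] on the diagonal. *)
Lemma approx_cubature_eps_ge0 (R : realType) (k d t n : nat) (eps : R)
  (dS : measure_display) (TS : measurableType dS) (PS : probability TS R)
  (Q : TS -> 'M[R]_d) (P : 'I_n -> 'M[R]_d) (w : 'I_n -> R) :
  (0 < k)%N -> grass_law k PS Q -> approx_cubature k t eps PS Q P w -> 0 <= eps.
Proof.
move=> k0 [_ [gQ _]] [_ H]; have [w0 _] := @ae_exists R _ _ PS _ (aeW PS (fun=> I)).
have kt : (0 : R) < k%:R ^+ t by rewrite exprn_gt0 // ltr0n.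
have := H 1%N (fun=> Num.sqrt (k%:R ^+ t)^-1) (fun=> Q w0) (fun=> gQ w0).
rewrite /Kt_norm2 !big_ord1 -expr2 sqr_sqrtr ?invr_ge0 ?(ltW kt) //.
have [_ [Qi Qt]] := gQ w0; rewrite /= {1}/hsprod Qi Qt mulVf ?gt_eqF // => /(_ erefl).
by move=> h; rewrite -lee_fin; apply: le_trans h; exact: abse_ge0.
Qed.

Lemma Kt_fun_integrable (R : realType) (k d t m : nat) (dS : measure_display)
  (TS : measurableType dS) (PS : probability TS R) (Q : TS -> 'M[R]_d)
  (c : 'I_m -> R) (Qs : 'I_m -> 'M[R]_d) : grass_law k PS Q ->
  PS.-integrable setT (EFin \o (fun w => Kt_fun t c Qs (Q w))).
Proof.
move=> lawQ.
have h (l : 'I_m) : PS.-integrable setT (EFin \o (fun w => hsprod (Qs l) (Q w) ^+ t)).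
  have -> : (fun w => hsprod (Qs l) (Q w) ^+ t) =
    (fun w => \sum_(I : {ffun 'I_t -> 'I_d * 'I_d})
      tpow t (pairv (Qs l)) I * \prod_(r < t) Q w (I r).1 (I r).2).
    apply/funext => w; have [_ [gQ _]] := lawQ; have [Qsym _] := gQ w.
    by rewrite hsprod_pairv // -dot_tpow.
  apply: (integrable_lincomb _ _ _).1 => I _.
  exact: (prod_entries_integrable _ _ lawQ).
exact: (integrable_lincomb (index_enum _) (P := xpredT) c (fun l _ => h l)).1.
Qed.

(** The defining inequality extends from norm 1 by scaling. In norm zero the representing tensor is
    zero, so the function vanishes on the Grassmannian and so does its error. *)
Lemma approx_cubature_bound (R : realType) (k d t n : nat) (eps : R)
  (dS : measure_display) (TS : measurableType dS) (PS : probability TS R)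
  (Q : TS -> 'M[R]_d) (P : 'I_n -> 'M[R]_d) (w : 'I_n -> R)
  (m : nat) (c : 'I_m -> R) (Qs : 'I_m -> 'M[R]_d) :
  (0 < k)%N -> grass_law k PS Q -> approx_cubature k t eps PS Q P w ->
  (forall i, grass k (Qs i)) ->
  `| \sum_(j < n) w j * Kt_fun t c Qs (P j) - \int[PS]_x Kt_fun t c Qs (Q x) |
    <= eps * Num.sqrt (Kt_norm2 t c Qs).
Proof.
move=> k0 lawQ app gQs; have eps0 := approx_cubature_eps_ge0 k0 lawQ app.
have [_ [gQ _]] := lawQ; have [gP H] := app.
set nu := Num.sqrt _.
have nu2 : nu ^+ 2 = Kt_norm2 t c Qs.
  by rewrite sqr_sqrtr // (Kt_norm2_dot _ _ gQs) dot_ge0.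
have [nu0|nu0] := eqVneq nu 0.
  have b0 : lincomb c (fun l => tpow t (pairv (Qs l))) = (fun=> 0).
    by apply: dot_eq0; rewrite -(Kt_norm2_dot _ _ gQs) -nu2 nu0 expr0n.
  have K0 A : grass k A -> Kt_fun t c Qs A = 0.
    by move=> gA; rewrite (Kt_fun_dot _ _ _ gA) b0 /dot big1 // => I _; rewrite mul0r.
  rewrite nu0 mulr0 big1 => [|j _]; last by rewrite K0 ?mulr0.
  under eq_Rintegral do rewrite K0 //.
  by rewrite Rintegral_cst // mul0r subr0 normr0.
have nu_gt0 : 0 < nu by rewrite lt_def nu0 sqrtr_ge0.
have Kscale A : Kt_fun t (fun i => nu^-1 * c i) Qs A = nu^-1 * Kt_fun t c Qs A.
  by rewrite /Kt_fun mulr_sumr; apply: eq_bigr => i _; rewrite mulrA.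
have := H m (fun i => nu^-1 * c i) Qs gQs.
have -> : Kt_norm2 t (fun i => nu^-1 * c i) Qs = 1.
  transitivity (nu^-1 ^+ 2 * Kt_norm2 t c Qs); last first.
    by rewrite -nu2 -exprMn mulVf // expr1n.
  rewrite /Kt_norm2 mulr_sumr; apply: eq_bigr => i _; rewrite mulr_sumr.
  by apply: eq_bigr => j _; ring.
move=> /(_ erefl); rewrite /sigma_int expectation_Rintegral; last first.
  exact: Kt_fun_integrable lawQ.
rewrite -EFinB abse_EFin lee_fin.
under eq_bigr do rewrite Kscale mulrCA.
under eq_Rintegral do rewrite Kscale.
rewrite -mulr_sumr RintegralZl //; last exact: Kt_fun_integrable lawQ.
by rewrite -mulrBr normrM gtr0_norm ?invr_gt0 // mulrC ler_pdivrMr.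
Qed.

Lemma approx_cubature_tpow (R : realType) (k d t n : nat) (eps : R)
  (dS : measure_display) (TS : measurableType dS) (PS : probability TS R)
  (Q : TS -> 'M[R]_d) (P : 'I_n -> 'M[R]_d) (w : 'I_n -> R)
  (a : {ffun 'I_t -> 'I_d} -> R) (x : 'I_d -> R) :
  (0 < k)%N -> grass_law k PS Q -> approx_cubature k t eps PS Q P w ->
  in_span (@is_tpow R _ t) a ->
  `| \sum_(j < n) w j * dot a (tpow t (mxv (P j) x)) -
     \int[PS]_v dot a (tpow t (mxv (Q v) x)) |
    <= eps * (Num.sqrt (dot a a) * Num.sqrt (dot x x) ^+ t).
Proof.
move=> k0 lawQ app aS.
have [_ [gQ _]] := lawQ; have [gP _] := app.
have [m [c [z aE]]] := in_span_tpow aS.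
(* The tensor representing the integrand as a function of the matrix: its pairing with the tensor
   power of [A] is [dot a (tpow t (mxv A x))]. *)
pose tau := lincomb c (fun l => tpow t (outer (z l) x)).
have tauP A : dot tau (tpow t (pairv A)) = dot a (tpow t (mxv A x)).
  rewrite aE !dot_lincomb; apply: eq_bigr => l _.
  by rewrite !dot_tpow dot_outer_pairv.
have tautau : dot tau tau = dot a a * dot x x ^+ t.
  rewrite aE !dot_lincomb mulr_suml; apply: eq_bigr => l _.
  rewrite ![dot _ (lincomb _ _)]dotC !dot_lincomb -mulrA mulr_suml.
  congr (_ * _); apply: eq_bigr => l' _.
  by rewrite !dot_tpow dot_outer exprMn mulrA.
pose S (u : {ffun 'I_t -> 'I_d * 'I_d} -> R) :=
  exists A, grass k A /\ u = tpow t (pairv A).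
(* Projecting [tau] onto the span of the Grassmannian's tensor powers keeps its pairings there,
   makes it a kernel combination [Kt_fun t c' Qs], and does not increase its norm. *)
have [b [[m' [c' [v [/choice[Qs hQs] bE]]]] hb bb]] := span_representer S tau.
have gQs i : grass k (Qs i) by case: (hQs i).
have bE' : b = lincomb c' (fun l => tpow t (pairv (Qs l))).
  by rewrite bE; congr lincomb; apply/funext => l; case: (hQs l).
have KE A : grass k A -> dot a (tpow t (mxv A x)) = Kt_fun t c' Qs A.
  by move=> gA; rewrite (Kt_fun_dot _ _ _ gA) -bE' -tauP hb //; exists A.
under eq_bigr do rewrite KE //.
under eq_Rintegral do rewrite KE //.
apply: le_trans (approx_cubature_bound c' k0 lawQ app gQs) _.
apply: ler_wpM2l; first exact: approx_cubature_eps_ge0 app.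
rewrite (Kt_norm2_dot _ _ gQs) -bE'.
rewrite -(ger0_norm (exprn_ge0 t (sqrtr_ge0 (dot x x)))) -sqrtr_sqr.
rewrite exprAC sqr_sqrtr ?dot_ge0 // -sqrtrM ?dot_ge0 //.
by rewrite ler_wsqrtr // -tautau.
Qed.

(** * From words to multi-indices and random vectors *)

(** The multi-index of letter counts of a word; counts are at most [t], so [inord] never takes its
    default value. *)
Definition content (d t : nat) (I : {ffun 'I_t -> 'I_d}) : {ffun 'I_d -> 'I_t.+1} :=
  [ffun i => inord #|[pred r | I r == i]|].

Lemma contentE (d t : nat) (I : {ffun 'I_t -> 'I_d}) (i : 'I_d) :
  content I i = #|[pred r | I r == i]| :> nat.
Proof. by rewrite ffunE inordK // ltnS -[leqRHS]card_ord max_card. Qed.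

Lemma mono_content (R : realType) (d t : nat) (I : {ffun 'I_t -> 'I_d})
  (y : 'I_d -> R) : mono (fun i => content I i : nat) y = tpow t y I.
Proof.
rewrite /tpow (partition_big I xpredT) //=; apply: eq_bigr => i _.
rewrite contentE -prodr_const; apply: eq_big => [r|r /eqP <- //].
by rewrite inE.
Qed.

Lemma mdeg_content (d t : nat) (I : {ffun 'I_t -> 'I_d}) : mdeg (content I) = t.
Proof.
rewrite /mdeg -[RHS]card_ord -sum1_card (partition_big I xpredT) //=.
by apply: eq_bigr => i _; rewrite contentE -sum1_card; apply: eq_bigl => r; rewrite inE.
Qed.

(** Words with the same content give the same monomial, so their coefficients are added up. *)
Definition collect (R : realType) (d t : nat) (a : {ffun 'I_t -> 'I_d} -> R)
  (beta : {ffun 'I_d -> 'I_t.+1}) : R := \sum_(I | content I == beta) a I.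

Lemma sum_collect (R : realType) (d t : nat) (a : {ffun 'I_t -> 'I_d} -> R)
  (y : 'I_d -> R) :
  \sum_(beta : {ffun 'I_d -> 'I_t.+1} | mdeg beta == t)
    collect a beta * mono (fun i => beta i : nat) y = dot a (tpow t y).
Proof.
rewrite /dot (partition_big (@content d t) (fun b => mdeg b == t)) /=; last first.
  by move=> I _; rewrite mdeg_content.
apply: eq_bigr => b _; rewrite mulr_suml; apply: eq_bigr => I /eqP <-.
by rewrite mono_content.
Qed.

Lemma mono_tpow (R : realType) (d t : nat) (alpha : 'I_d -> nat) :
  (\sum_i alpha i)%N = t -> exists A : {ffun 'I_t -> 'I_d},
    forall x : 'I_d -> R, mono alpha x = tpow t x A.
Proof.
move=> at_.
(* The word in which each letter [i] is repeated [alpha i] times. *)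
pose s := flatten [seq nseq (alpha i) i | i <- index_enum 'I_d].
have ss : size s = t.
  rewrite size_flatten /shape -map_comp sumnE big_map -at_.
  by apply: eq_bigr => i _; rewrite /= size_nseq.
have ss' : size s == t by apply/eqP.
exists [ffun r => tnth (Tuple ss') r] => x.
transitivity (\prod_(i <- s) x i).
  rewrite /s big_flatten /= big_map; apply: eq_bigr => i _.
  by rewrite big_nseq -Monoid.iteropE.
rewrite -[s]/(tval (Tuple ss')) big_tuple /tpow.
by apply: eq_bigr => r _; rewrite ffunE.
Qed.

Lemma enormE (R : realType) (d : nat) (x : 'I_d -> R) :
  enorm x = Num.sqrt (dot x x).
Proof. by rewrite /enorm; congr Num.sqrt; apply: eq_bigr => i _; rewrite expr2. Qed.

Lemma enorm_mxv_grass (R : realType) (k d : nat) (P : 'M[R]_d) (x : 'I_d -> R) :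
  grass k P -> enorm (mxv P x) <= enorm x.
Proof.
move=> gP; rewrite !enormE ler_wsqrtr //.
(* Pythagoras for [x] and its projection; the factor [1] gives the difference the shape expected by
   [dotBZ]. *)
have := dot_ge0 (fun i => x i - 1 * mxv P x i).
rewrite dotBZ ![dot (fun i => x i - _) _]dotC !dotBZ !mul1r.
rewrite [dot (mxv P x) x]dotC (dot_mxv_grass _ _ gP) subrr subr0.
by rewrite subr_ge0.
Qed.

Lemma mono_le_enorm (R : realType) (d t : nat) (beta : 'I_d -> nat)
  (x : 'I_d -> R) : (\sum_i beta i)%N = t -> `|mono beta x| <= enorm x ^+ t.
Proof.
move=> <-; rewrite /mono normr_prod -prodrXr; apply: ler_prod => i _.
rewrite normr_ge0 normrX /= lerXn2r ?nnegrE ?sqrtr_ge0 //.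
rewrite /enorm -sqrtr_sqr ler_wsqrtr // (bigD1 i) //= lerDl.
by apply: sumr_ge0 => j _; rewrite sqr_ge0.
Qed.

Lemma mono_measurable (R : realType) (d : nat) (dT : measure_display)
  (T : measurableType dT) (beta : 'I_d -> nat) (X : 'I_d -> T -> R) :
  (forall i, measurable_fun setT (X i)) ->
  measurable_fun setT (fun x => mono beta (fun i => X i x)).
Proof.
by move=> mX; apply: measurable_prod => i _; apply: measurable_funX.
Qed.

Lemma mxv_measurable (R : realType) (d : nat) (dT : measure_display)
  (T : measurableType dT) (P : 'M[R]_d) (X : 'I_d -> T -> R) (i : 'I_d) :
  (forall i, measurable_fun setT (X i)) ->
  measurable_fun setT (fun x => mxv P (fun l => X l x) i).
Proof.
by move=> mX; apply: measurable_sum => l; apply: measurable_funM.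
Qed.

Lemma enorm_integrable (R : realType) (d t : nat) (dT : measure_display)
  (T : measurableType dT) (Pr : probability T R) (X : 'I_d -> T -> R) :
  (forall i, measurable_fun setT (X i)) ->
  ('E_Pr[fun x => (enorm (fun i => X i x) ^+ t)%R] < +oo)%E ->
  Pr.-integrable setT (EFin \o (fun x => enorm (fun i => X i x) ^+ t)).
Proof.
move=> mX; rewrite unlock => Eoo; apply/integrableP; split.
  apply/measurable_EFinP; apply: measurable_funX.
  apply: (measurableT_comp (f := @Num.sqrt R)).
    by apply: continuous_measurable_fun; exact: sqrt_continuous.
  by apply: measurable_sum => i; apply: measurable_funX.
under eq_integral do rewrite /= ger0_norm ?exprn_ge0 ?sqrtr_ge0 //.
exact: Eoo.
Qed.

(** Gathers the moments of the projections into the expectation of one function of the outcome, so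
    that errors can be estimated pointwise. Each monomial of degree [t] in [P_j X] is dominated by
    the [t]-th power of the norm of [X]. *)
Lemma expectation_cubature_sum (R : realType) (k d t n : nat)
  (dT : measure_display) (T : measurableType dT) (Pr : probability T R)
  (X : 'I_d -> T -> R) (P : 'I_n -> 'M[R]_d) (w : 'I_n -> R)
  (a : {ffun 'I_t -> 'I_d} -> R) :
  (forall j, grass k (P j)) -> (forall i, measurable_fun setT (X i)) ->
  ('E_Pr[fun x => (enorm (fun i => X i x) ^+ t)%R] < +oo)%E ->
  let F x := \sum_(j < n) w j * dot a (tpow t (mxv (P j) (fun i => X i x))) in
  Pr.-integrable setT (EFin \o F) /\
  (\sum_(beta : {ffun 'I_d -> 'I_t.+1} | mdeg beta == t) ((collect a beta)%:E *
     \sum_(j < n) ((w j)%:E *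
       'E_Pr[fun x => mono (fun i => beta i : nat) (mxv (P j) (fun i => X i x))]))
   = (\int[Pr]_x F x)%:E)%E.
Proof.
move=> gP mX Eoo F; have Xi := enorm_integrable mX Eoo.
pose G j (beta : {ffun 'I_d -> 'I_t.+1}) x :=
  mono (fun i => beta i : nat) (mxv (P j) (fun i => X i x)).
have Gi j beta : mdeg beta == t -> Pr.-integrable setT (EFin \o G j beta).
  move=> /eqP bt; apply: integrable_dominated Xi.
    by apply: (mono_measurable _ (X := fun i x => _)) => i; exact: mxv_measurable.
  move=> x; apply: le_trans (mono_le_enorm _ bt) _.
  by apply: lerXn2r; rewrite ?nnegrE ?sqrtr_ge0 // (enorm_mxv_grass _ (gP j)).
have Hj j := integrable_lincomb (index_enum _) (P := fun b => mdeg b == t)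
  (collect a) (Gi j).
have FE : F = fun x => \sum_(j < n) w j *
    \sum_(beta : {ffun 'I_d -> 'I_t.+1} | mdeg beta == t) collect a beta * G j beta x.
  by apply/funext => x; apply: eq_bigr => j _; rewrite sum_collect.
have [H1 H2] := integrable_lincomb (index_enum _) (P := xpredT) w
  (fun j _ => (Hj j).1).
rewrite FE; split; first exact: H1.
rewrite H2.
transitivity (\sum_(beta : {ffun 'I_d -> 'I_t.+1} | mdeg beta == t)
    (collect a beta * \sum_(j < n) w j * \int[Pr]_x G j beta x)%:E)%E.
  apply: eq_bigr => beta bt; rewrite EFinM; congr (_ * _)%E; rewrite -sumEFin.
  by apply: eq_bigr => j _; rewrite expectation_Rintegral ?EFinM //; exact: Gi.
rewrite sumEFin; congr EFin.
under [RHS]eq_bigr do rewrite (Hj _).2 mulr_sumr.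
rewrite exchange_big; apply: eq_bigr => beta _; rewrite mulr_sumr.
by apply: eq_bigr => j _; rewrite mulrCA.
Qed.

(** Common source of both parts of the theorem: the rank bound [l] is left free to be set to 2 or 3,
    and a finite [t]-th moment also covers vectors on the sphere. *)
Lemma homogeneous_cubature (R : realType) (k d t : nat)
  (dS : measure_display) (TS : measurableType dS) (PS : probability TS R)
  (Q : TS -> 'M[R]_d) (alpha : 'I_d -> nat) :
  (0 < k)%N -> (0 < t)%N -> grass_law k PS Q -> (\sum_(i < d) alpha i)%N = t ->
  exists (a : {ffun 'I_d -> 'I_t.+1} -> R) (c : R), 0 <= c /\
   (forall (l n : nat) (P : 'I_n -> 'M[R]_d) (w : 'I_n -> R), (2 <= l)%N ->
      cubature k (@in_PolL R l t k d) PS Q P w ->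
      forall (dT : measure_display) (T : measurableType dT)
             (Pr : probability T R) (X : 'I_d -> T -> R),
      (forall i, measurable_fun setT (X i)) ->
      ('E_Pr[fun x => (enorm (fun i => X i x) ^+ t)%R] < +oo)%E ->
      ('E_Pr[fun x => mono alpha (fun i => X i x)] =
       \sum_(beta | mdeg beta == t) ((a beta)%:E *
          \sum_(j < n) ((w j)%:E *
             'E_Pr[fun x => mono (fun i => beta i : nat) (mxv (P j) (fun i => X i x))])))%E) /\
   (forall (eps : R) (n : nat) (P : 'I_n -> 'M[R]_d) (w : 'I_n -> R),
      approx_cubature k t eps PS Q P w ->
      forall (dT : measure_display) (T : measurableType dT)
             (Pr : probability T R) (X : 'I_d -> T -> R),
      (forall i, measurable_fun setT (X i)) ->
      ('E_Pr[fun x => (enorm (fun i => X i x) ^+ t)%R] < +oo)%E ->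
      (`| 'E_Pr[fun x => mono alpha (fun i => X i x)] -
          \sum_(beta | mdeg beta == t) ((a beta)%:E *
             \sum_(j < n) ((w j)%:E *
               'E_Pr[fun x => mono (fun i => beta i : nat) (mxv (P j) (fun i => X i x))])) |
        <= (c * eps)%:E * 'E_Pr[fun x => (enorm (fun i => X i x) ^+ t)%R])%E).
Proof.
move=> k0 t0 lawQ at_; have [A hA] := mono_tpow R at_.
(* The chosen tensor is the indicator of the word [A], whose pairing with [tpow t x] is the monomial
   of exponent [alpha]. *)
have [a [aS ha]] := moment_reconstruction (fun I => (I == A)%:R) k0 t0 lawQ.
have monoE x : mono alpha x = \int[PS]_v dot a (tpow t (mxv (Q v) x)).
  rewrite ha hA /dot (bigD1 A) //= eqxx mul1r big1 ?addr0 // => I /negbTE ->.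
  by rewrite mul0r.
have alphaI (dT : measure_display) (T : measurableType dT)
    (Pr : probability T R) (X : 'I_d -> T -> R) :
    (forall i, measurable_fun setT (X i)) ->
    ('E_Pr[fun x => (enorm (fun i => X i x) ^+ t)%R] < +oo)%E ->
    Pr.-integrable setT (EFin \o (fun x => mono alpha (fun i => X i x))).
  move=> mX Eoo; apply: integrable_dominated (enorm_integrable mX Eoo).
    exact: mono_measurable.
  by move=> x; exact: mono_le_enorm.
(* The constant is the Euclidean norm of the tensor [a]. *)
exists (collect a), (Num.sqrt (dot a a)); split; first exact: sqrtr_ge0.
split=> [l n P w l2 [gP cub] dT T Pr X mX Eoo|eps n P w app dT T Pr X mX Eoo].
  have [_ ->] := expectation_cubature_sum w a gP mX Eoo.
  rewrite expectation_Rintegral; last exact: alphaI.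
  congr EFin; apply: eq_Rintegral => x _; rewrite monoE.
  have := cub _ (in_PolL_dot_tpow k (fun i => X i x) l2 aS).
  rewrite /sigma_int expectation_Rintegral => [[->] //|].
  exact: integrable_dot_tpow lawQ.
have [gP _] := app.
have [Fi ->] := expectation_cubature_sum w a gP mX Eoo.
have Ai := alphaI _ _ _ _ mX Eoo; have Ni := enorm_integrable mX Eoo.
rewrite !expectation_Rintegral // -EFinB abse_EFin -EFinM lee_fin.
rewrite -RintegralB // -RintegralZl //.
have Di : Pr.-integrable setT (EFin \o (fun x => mono alpha (fun i => X i x) -
    \sum_(j < n) w j * dot a (tpow t (mxv (P j) (fun i => X i x))))).
  exact: (integrableB measurableT Ai Fi).
apply: le_trans (le_normr_Rintegral measurableT Di) _.
apply: le_Rintegral => //; first exact: integrable_norm.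
  exact: (integrableZl measurableT _ Ni).
(* For each outcome, the monomial is an average over [Q], so the integrand is a cubature error at a
   fixed vector. *)
move=> x _; rewrite distrC monoE.
apply: le_trans (approx_cubature_tpow _ k0 lawQ app aS) _.
by rewrite enormE mulrA (mulrC eps).
Qed.

(** * Specialisation to the unit sphere and to [k = 1] *)

Unset Implicit Arguments.
Set Strict Implicit.
Set Printing Implicit Defensive.

Theorem theorem6p1 (R : realType) (k d t : nat)
  (dS : measure_display) (TS : measurableType dS) (PS : probability TS R)
  (Q : TS -> 'M[R]_d) :
  (1 <= k)%N -> (k < d)%N -> (1 <= t)%N -> grass_law k PS Q ->
  (* (i) *)
  (forall alpha : 'I_d -> nat, (\sum_(i < d) alpha i)%N = t ->
   exists (a : {ffun 'I_d -> 'I_t.+1} -> R) (c : R), 0 <= c /\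
   (forall (n : nat) (P : 'I_n -> 'M[R]_d) (w : 'I_n -> R),
      cubature k (@in_PolL R 2 t k d) PS Q P w ->
      forall (dT : measure_display) (T : measurableType dT)
             (Pr : probability T R) (X : 'I_d -> {RV Pr >-> R}),
      (forall x, enorm (fun i => X i x) = (1 : R)) ->
      ('E_Pr[fun x => mono alpha (fun i => X i x)] =
       \sum_(beta | (mdeg beta <= t)%N) ((a beta)%:E *
          \sum_(j < n) ((w j)%:E *
             'E_Pr[fun x => mono (fun i => beta i : nat) (mxv (P j) (fun i => X i x))])))%E) /\
   (forall eps : R, 0 <= eps ->
      forall (n : nat) (P : 'I_n -> 'M[R]_d) (w : 'I_n -> R),
      approx_cubature k t eps PS Q P w ->
      forall (dT : measure_display) (T : measurableType dT)
             (Pr : probability T R) (X : 'I_d -> {RV Pr >-> R}),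
      (forall x, enorm (fun i => X i x) = (1 : R)) ->
      (`| 'E_Pr[fun x => mono alpha (fun i => X i x)] -
          \sum_(beta | (mdeg beta <= t)%N) ((a beta)%:E *
             \sum_(j < n) ((w j)%:E *
               'E_Pr[fun x => mono (fun i => beta i : nat) (mxv (P j) (fun i => X i x))])) |
        <= (eps * c)%:E)%E)) /\
  (* (ii) *)
  (k = 1%N -> (t <= d)%N ->
   forall alpha : 'I_d -> nat, (\sum_(i < d) alpha i)%N = t ->
   exists (a : {ffun 'I_d -> 'I_t.+1} -> R) (c : R), 0 <= c /\
   (forall (n : nat) (P : 'I_n -> 'M[R]_d) (w : 'I_n -> R),
      cubature k (@in_PolL R 3 t k d) PS Q P w ->
      forall (dT : measure_display) (T : measurableType dT)
             (Pr : probability T R) (X : 'I_d -> {RV Pr >-> R}),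
      ('E_Pr[fun x => (enorm (fun i => X i x) ^+ t)%R] < +oo)%E ->
      ('E_Pr[fun x => mono alpha (fun i => X i x)] =
       \sum_(beta | mdeg beta == t) ((a beta)%:E *
          \sum_(j < n) ((w j)%:E *
             'E_Pr[fun x => mono (fun i => beta i : nat) (mxv (P j) (fun i => X i x))])))%E) /\
   (forall eps : R,
      forall (n : nat) (P : 'I_n -> 'M[R]_d) (w : 'I_n -> R),
      approx_cubature k t eps PS Q P w ->
      forall (dT : measure_display) (T : measurableType dT)
             (Pr : probability T R) (X : 'I_d -> {RV Pr >-> R}),
      ('E_Pr[fun x => (enorm (fun i => X i x) ^+ t)%R] < +oo)%E ->
      (`| 'E_Pr[fun x => mono alpha (fun i => X i x)] -
          \sum_(beta | mdeg beta == t) ((a beta)%:E *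
             \sum_(j < n) ((w j)%:E *
               'E_Pr[fun x => mono (fun i => beta i : nat) (mxv (P j) (fun i => X i x))])) |
        <= (c * eps)%:E * 'E_Pr[fun x => (enorm (fun i => X i x) ^+ t)%R])%E)).
Proof.
move=> k1 kd t1 lawQ; split.
  move=> alpha at_.
  have [a [c [c0 [exact_ approx_]]]] := homogeneous_cubature k1 t1 lawQ at_.
  (* The homogeneous coefficients are extended by zero to the lower degrees. *)
  exists (fun beta => if mdeg beta == t then a beta else 0), c; split=> //.
  have restrict (F : {ffun 'I_d -> 'I_t.+1} -> \bar R) :
      (\sum_(beta | (mdeg beta <= t)%N)
         ((if mdeg beta == t then a beta else 0)%:E * F beta) =
       \sum_(beta | mdeg beta == t) ((a beta)%:E * F beta))%E.
    rewrite (bigID (fun beta => mdeg beta == t)) /=.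
    rewrite [X in (_ + X)%E]big1 ?adde0 => [|beta /andP[_ /negbTE ->]]; last first.
      by rewrite mul0e.
    apply: eq_big => [beta|beta /andP[_ ->] //].
    by case: eqP => [->|_]; rewrite ?leqnn ?andbF.
  have sphere (dT : measure_display) (T : measurableType dT)
      (Pr : probability T R) (X : 'I_d -> {RV Pr >-> R}) :
      (forall x, enorm (fun i => X i x) = (1 : R)) ->
      ('E_Pr[fun x => (enorm (fun i => X i x) ^+ t)%R] = 1)%E.
    move=> X1; rewrite -(expectation_cst Pr 1); congr expectation.
    by apply/funext => x; rewrite X1 expr1n.
  split=> [n P w cub dT T Pr X X1|eps eps0 n P w app dT T Pr X X1].
    rewrite restrict; apply: (exact_ 2 n P w _ cub dT T Pr) => //.
    by rewrite sphere // ltry.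
  rewrite restrict mulrC.
  have := approx_ eps n P w app dT T Pr (fun i => X i) (fun i => measurable_funPT (X i)).
  by rewrite sphere // mule1; apply; rewrite ltry.
move=> _ _ alpha at_.
have [a [c [c0 [exact_ approx_]]]] := homogeneous_cubature k1 t1 lawQ at_.
exists a, c; split=> //; split=> [n P w cub dT T Pr X Eoo|eps n P w app dT T Pr X Eoo].
  exact: (exact_ 3 n P w _ cub dT T Pr (fun i => X i)).
exact: (approx_ eps n P w app dT T Pr (fun i => X i)).
Qed.
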